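(* Let $\mathcal{V}$ be a non-trivial commutative unital quantale. The Hausdorff functor $\mathsf{H}\colon\mathcal{V}\text{-}\mathsf{Cat}\to\mathcal{V}\text{-}\mathsf{Cat}$ does not admit a terminal coalgebra. Moreover, for every full subcategory $\mathsf{X}$ of $\mathcal{V}\text{-}\mathsf{Cat}$ to which $\mathsf{H}$ restricts, the restriction $\mathsf{H}\colon\mathsf{X}\to\mathsf{X}$ does not admit a terminal coalgebra.
   Context: A commutative unital quantale $\mathcal{V}=(\mathcal{V},\otimes,k)$ is a complete lattice with a commutative monoid structure $(\otimes,k)$ such that $u\otimes-$ preserves arbitrary suprema for each $u$. It is trivial if $\mathcal{V}=\{k\}$, and non-trivial otherwise. A $\mathcal{V}$-category $(X,a)$ is a set $X$ with a map $a\colon X\times X\to\mathcal{V}$ such that $k\le a(x,x)$ and $a(x,y)\otimes a(y,z)\le a(x,z)$ for all $x,y,z\in X$. A $\mathcal{V}$-functor $f\colon(X,a)\to(Y,b)$ is a map with $a(x,y)\le b(f(x),f(y))$ for all $x,y$. These form the category $\mathcal{V}\text{-}\mathsf{Cat}$. For $A\subseteq X$ put $\uparrow\! A=\{y\in X\mid k\le\bigvee_{x\in A}a(x,y)\}$; $A$ is called increasing if $A=\uparrow\! A$. The Hausdorff functor $\mathsf{H}\colon\mathcal{V}\text{-}\mathsf{Cat}\to\mathcal{V}\text{-}\mathsf{Cat}$ sends $(X,a)$ to $\mathsf{H}X=\{A\subseteq X\mid A\text{ is increasing}\}$ with structure $\mathsf{H}a(A,B)=\bigwedge_{y\in B}\bigvee_{x\in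 A}a(x,y)$, and a $\mathcal{V}$-functor $f\colon X\to Y$ to $\mathsf{H}f\colon\mathsf{H}X\to\mathsf{H}Y$, $A\mapsto\uparrow\! f(A)$. A coalgebra for an endofunctor $F$ of a category $\mathsf{C}$ is a morphism $c\colon C\to FC$; a homomorphism $(C,c)\to(D,d)$ is $h\colon C\to D$ with $d\cdot h=Fh\cdot c$; a terminal coalgebra is a terminal object of the resulting category. *)

(* Defs.v *)
From HB Require Import structures.
From mathcomp Require Import all_boot all_order.
From mathcomp Require Import all_classical.

Set Implicit Arguments.
Unset Strict Implicit.
Unset Printing Implicit Defensive.

Import Order.TTheory.

Local Open Scope classical_set_scope.
Local Open Scope order_scope.
Local Open Scope group_scope.

Record category := Category {
  obj :> Type;
  hom : obj -> obj -> Type;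
  idm : forall X, hom X X;
  compm : forall X Y Z, hom Y Z -> hom X Y -> hom X Z;
  compm_idl : forall X Y (f : hom X Y), compm (idm Y) f = f;
  compm_idr : forall X Y (f : hom X Y), compm f (idm X) = f;
  compmA : forall W X Y Z (h : hom Y Z) (g : hom X Y) (f : hom W X),
    compm h (compm g f) = compm (compm h g) f }.

Arguments idm {c} X.
Arguments compm {c X Y Z} g f.

Record endofunctor (C : category) := Endofunctor {
  fobj :> C -> C;
  fmor : forall X Y, hom X Y -> hom (fobj X) (fobj Y);
  fmor_id : forall X, fmor (idm X) = idm (fobj X);
  fmor_comp : forall X Y Z (g : hom Y Z) (f : hom X Y),
    fmor (compm g f) = compm (fmor g) (fmor f) }.

Arguments fmor {C} F {X Y} f : rename.

Definition terminal (C : category) (T : C) : Prop :=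
  forall X : C, exists f : hom X T, forall g : hom X T, g = f.

Definition full_subcategory (C : category) (P : C -> Prop) : category :=
  @Category {X : C | P X} (fun X Y => hom (sval X) (sval Y))
    (fun X => idm (sval X)) (fun X Y Z g f => compm g f)
    (fun X Y f => compm_idl f) (fun X Y f => compm_idr f)
    (fun W X Y Z h g f => compmA h g f).

Definition restricts_to (C : category) (F : endofunctor C) (P : C -> Prop) :=
  forall X, P X -> P (F X).

Definition restriction (C : category) (F : endofunctor C) (P : C -> Prop)
    (FP : restricts_to F P) : endofunctor (full_subcategory P) :=
  @Endofunctor (full_subcategory P)
    (fun X => exist P (F (sval X)) (FP _ (svalP X)))
    (fun X Y f => fmor F f)
    (fun X => fmor_id F (sval X)) (fun X Y Z g f => fmor_comp F g f).

Section Coalgebras.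
Variables (C : category) (F : endofunctor C).

Record coalgebra := Coalgebra {
  coalg_obj : C;
  coalg_map : hom coalg_obj (F coalg_obj) }.

Definition is_coalg_hom (c d : coalgebra)
    (h : hom (coalg_obj c) (coalg_obj d)) : Prop :=
  compm (coalg_map d) h = compm (fmor F h) (coalg_map c).

Definition coalg_hom (c d : coalgebra) :=
  {h : hom (coalg_obj c) (coalg_obj d) | is_coalg_hom h}.

Lemma coalg_hom_eq c d (f g : coalg_hom c d) : sval f = sval g -> f = g.
Proof. by case: f g => f hf [g hg] /= fg; exact: eq_exist. Qed.

Lemma is_coalg_hom_id c : is_coalg_hom (idm (coalg_obj c)).
Proof. by rewrite /is_coalg_hom fmor_id compm_idl compm_idr. Qed.

Lemma is_coalg_hom_comp c d e (g : coalg_hom d e) (f : coalg_hom c d) :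
  is_coalg_hom (compm (sval g) (sval f)).
Proof.
case: g f => g hg [f hf] /=; rewrite /is_coalg_hom compmA hg -compmA hf.
by rewrite fmor_comp compmA.
Qed.

Definition coalgebras : category.
Proof.
apply: (@Category coalgebra coalg_hom
  (fun c => exist _ _ (is_coalg_hom_id c))
  (fun c d e g f => exist _ _ (is_coalg_hom_comp g f))).
- by move=> c d f; apply: coalg_hom_eq; exact: compm_idl.
- by move=> c d f; apply: coalg_hom_eq; exact: compm_idr.
- by move=> b c d e h g f; apply: coalg_hom_eq; exact: compmA.
Defined.

Definition admits_terminal_coalgebra : Prop :=
  exists T : coalgebras, terminal T.

End Coalgebras.

HB.mixin Record isCompleteLattice d (V : Type) of Order.POrder d V := {
  bigjoin : set V -> V;
  bigmeet : set V -> V;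
  bigjoinP : forall A : set V, supremums A (bigjoin A);
  bigmeetP : forall A : set V, infimums A (bigmeet A) }.

#[short(type="completeLatticeType")]
HB.structure Definition CompleteLattice d :=
  {V of isCompleteLattice d V & Order.POrder d V}.

(* The tensor and its neutral element k are written multiplicatively,
   as x * y and 1. *)
HB.mixin Record isComQuantale d (V : Type)
    of CompleteLattice d V & Monoid V := {
  tensC : commutative (@mul V);
  tens_bigjoin : forall (u : V) (A : set V),
    u * bigjoin A = bigjoin [set u * v | v in A] }.

#[short(type="comQuantaleType")]
HB.structure Definition ComQuantale d :=
  {V of isComQuantale d V & CompleteLattice d V & Monoid V}.

Definition trivial_quantale d (V : comQuantaleType d) : Prop :=
  [set: V] = [set 1].

Section QuantaleTheory.
Context {d : Order.disp_t} {V : comQuantaleType d}.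
Implicit Types (u v w : V) (A : set V).

Lemma le_bigjoin A u : A u -> u <= bigjoin A.
Proof. by move=> Au; case: (bigjoinP A) => + _; apply. Qed.

Lemma bigjoin_le A u : (forall v, A v -> v <= u) -> bigjoin A <= u.
Proof. by move=> Au; case: (bigjoinP A) => _; apply. Qed.

Lemma bigmeet_le A u : A u -> bigmeet A <= u.
Proof. by move=> Au; case: (bigmeetP A) => + _; apply. Qed.

Lemma le_bigmeet A u : (forall v, A v -> u <= v) -> u <= bigmeet A.
Proof. by move=> Au; case: (bigmeetP A) => _; apply. Qed.

Lemma le_tensl w u v : u <= v -> w * u <= w * v.
Proof.
move=> uv; have -> : v = bigjoin [set u; v].
  apply/le_anti/andP; split; first by apply: le_bigjoin; right.
  by apply: bigjoin_le => _ [->|->].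
by rewrite tens_bigjoin; apply: le_bigjoin; exists u => //; left.
Qed.

Lemma le_tensr w u v : u <= v -> u * w <= v * w.
Proof. by rewrite ![_ * w]tensC; exact: le_tensl. Qed.

End QuantaleTheory.

Section VCategories.
Context {d : Order.disp_t} (V : comQuantaleType d).

Record vcategory := VCategory {
  vcarrier :> Type;
  vdist : vcarrier -> vcarrier -> V;
  vdist_refl : forall x, 1 <= vdist x x;
  vdist_trans : forall x y z, vdist x y * vdist y z <= vdist x z }.

Record vfunctor (X Y : vcategory) := VFunctor {
  vfun :> X -> Y;
  vfun_le : forall x y, vdist x y <= vdist (vfun x) (vfun y) }.

Lemma vfunctor_eq (X Y : vcategory) (f g : vfunctor X Y) : f =1 g -> f = g.
Proof.
case: f g => f hf [g hg] /= /funext fg; subst g.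
by congr VFunctor; exact: Prop_irrelevance.
Qed.

Definition vfunctor_id (X : vcategory) : vfunctor X X :=
  @VFunctor X X id (fun x y => lexx (vdist x y)).

Definition vfunctor_comp (X Y Z : vcategory) (g : vfunctor Y Z)
    (f : vfunctor X Y) : vfunctor X Z :=
  @VFunctor X Z (g \o f)
    (fun x y => le_trans (vfun_le f x y) (vfun_le g (f x) (f y))).

Definition VCat : category.
Proof.
apply: (@Category vcategory vfunctor vfunctor_id vfunctor_comp).
- by move=> X Y f; exact: vfunctor_eq.
- by move=> X Y f; exact: vfunctor_eq.
- by move=> W X Y Z h g f; exact: vfunctor_eq.
Defined.

Section Hausdorff.
Variable X : vcategory.
Implicit Types (A B : set X) (x y z : X).

Definition up A : set X := [set y | 1 <= bigjoin [set vdist x y | x in A]].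

Definition increasing A : Prop := A = up A.

Lemma bigjoin_vdist_trans A y z :
  bigjoin [set vdist x y | x in A] * vdist y z
    <= bigjoin [set vdist x z | x in A].
Proof.
rewrite tensC tens_bigjoin; apply: bigjoin_le => _ [_ [x Ax <-] <-].
rewrite tensC; apply: le_trans (vdist_trans x y z) _.
by apply: le_bigjoin; exists x.
Qed.

Lemma sub_up A : A `<=` up A.
Proof.
move=> y Ay; apply: le_trans (vdist_refl y) _.
by apply: le_bigjoin; exists y.
Qed.

Lemma bigjoin_up A y : bigjoin [set vdist x y | x in up A]
  = bigjoin [set vdist x y | x in A].
Proof.
apply/le_anti/andP; split.
  apply: bigjoin_le => _ [x Ax <-].
  apply: le_trans (bigjoin_vdist_trans A x y).
  by rewrite -{1}[vdist x y]mul1g; exact: le_tensr.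
apply: bigjoin_le => _ [x Ax <-]; apply: le_bigjoin; exists x => //.
exact: sub_up.
Qed.

Lemma increasing_up A : increasing (up A).
Proof.
by apply/seteqP; split=> y; rewrite /up /= bigjoin_up.
Qed.

Definition hdist A B : V :=
  bigmeet [set bigjoin [set vdist x y | x in A] | y in B].

Lemma hdist_refl A : 1 <= hdist A A.
Proof. by apply: le_bigmeet => _ [y Ay <-]; exact: sub_up. Qed.

Lemma hdist_trans A B D : hdist A B * hdist B D <= hdist A D.
Proof.
apply: le_bigmeet => _ [z Dz <-].
have hBz : hdist B D <= bigjoin [set vdist y z | y in B].
  by apply: bigmeet_le; exists z.
apply: le_trans (le_tensl _ hBz) _.
rewrite tens_bigjoin; apply: bigjoin_le => _ [_ [y By <-] <-].
apply: le_trans (bigjoin_vdist_trans A y z).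
by apply: le_tensr; apply: bigmeet_le; exists y.
Qed.

Definition hausdorff_obj : vcategory :=
  @VCategory {A : set X | increasing A}
    (fun S T => hdist (sval S) (sval T))
    (fun S => hdist_refl (sval S))
    (fun S T U => hdist_trans (sval S) (sval T) (sval U)).

End Hausdorff.

Section HausdorffMap.
Variables (X Y : vcategory) (f : vfunctor X Y).

Definition hausdorff_fun (A : hausdorff_obj X) : hausdorff_obj Y :=
  exist _ (up (f @` sval A)) (increasing_up (f @` sval A)).

Lemma hausdorff_fun_le (A B : hausdorff_obj X) :
  vdist A B <= vdist (hausdorff_fun A) (hausdorff_fun B).
Proof.
apply: le_bigmeet => _ [y By <-]; rewrite bigjoin_up.
rewrite -[vdist A B]mulg1; apply: le_trans (le_tensl _ By) _.
rewrite tens_bigjoin; apply: bigjoin_le => _ [_ [_ [x' Bx' <-] <-] <-].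
apply: le_trans (bigjoin_vdist_trans _ (f x') y); apply: le_tensr.
apply: (@le_trans _ _ (bigjoin [set vdist x x' | x in sval A])).
  by apply: bigmeet_le; exists x'.
apply: bigjoin_le => _ [x Ax <-]; apply: le_trans (vfun_le f x x') _.
by apply: le_bigjoin; exists (f x) => //; exists x.
Qed.

Definition hausdorff_map : vfunctor (hausdorff_obj X) (hausdorff_obj Y) :=
  VFunctor hausdorff_fun_le.

Lemma up_image_up (A : set X) : up (f @` up A) = up (f @` A).
Proof.
apply/seteqP; split; last first.
  move=> y; rewrite /up /= => Ay; apply: le_trans Ay _.
  apply: bigjoin_le => _ [_ [x Ax <-] <-]; apply: le_bigjoin.
  by exists (f x) => //; exists x => //; exact: sub_up.
move=> y; rewrite (increasing_up (f @` A)) /up /= => Ay.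
apply: le_trans Ay _; apply: bigjoin_le => _ [_ [x Ax <-] <-].
apply: le_bigjoin; exists (f x) => //; rewrite /up /=.
apply: le_trans Ax _; apply: bigjoin_le => _ [z Az <-].
apply: le_trans (vfun_le f z x) _.
by apply: le_bigjoin; exists (f z) => //; exists z.
Qed.

End HausdorffMap.

Definition hausdorff : endofunctor VCat.
Proof.
apply: (@Endofunctor VCat hausdorff_obj hausdorff_map).
- move=> X; apply: vfunctor_eq => -[A incA] /=; apply: eq_exist => /=.
  by rewrite image_id -incA.
- move=> X Y Z g f; apply: vfunctor_eq => -[A incA] /=.
  by apply: eq_exist => /=; rewrite up_image_up image_comp.
Defined.

End VCategories.

(* Main.v *)
Require Import Defs.
From mathcomp Require Import all_boot all_order.
From mathcomp Require Import all_classical.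

(** By Lambek's lemma the structure map [c] of a terminal coalgebra on [X] has
    a section [s : H X -> X]. Since [c] is a V-functor,
    [a (s A) (s B) <= Ha (c (s A)) (c (s B)) = Ha A B], so that [s] reflects
    distances. A diagonal argument in the style of Cantor and of
    Dilworth-Gleason shows that no map [H X -> X] does so
    ([no_reflecting_map]): in the set [U] generated by the points [s A] whose
    distance from [A] is bottom, [s U] would be a point at distance bottom from
    [U] and yet belong to [U], which gives [1 <= bottom] and so makes the
    quantale trivial. The argument concerns one object at a time, and Lambek's
    lemma is available in any category; hence it applies verbatim to the
    restriction of [H] to a full subcategory. *)

Set Implicit Arguments.
Unset Strict Implicit.
Unset Printing Implicit Defensive.

Import Order.TTheory.

Local Open Scope classical_set_scope.
Local Open Scope order_scope.
Local Open Scope group_scope.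

(** One half of Lambek's lemma. The section is the unique homomorphism into the
    terminal coalgebra from its own image under [F]; composing it with the
    structure map, which is itself a homomorphism, gives the identity. *)
Lemma terminal_coalgebra_section (C : category) (F : endofunctor C)
    (T : coalgebras F) :
  terminal T ->
  exists s : hom (F (coalg_obj T)) (coalg_obj T),
    compm (coalg_map T) s = idm (F (coalg_obj T)).
Proof.
move=> termT; pose c := coalg_map T.
have [[s hs] _] := termT (Coalgebra (fmor F c)).
have [e eP] := termT T.
exists s; rewrite /is_coalg_hom /= in hs.
have sc_hom : @is_coalg_hom C F T T (compm s c).
  by rewrite /is_coalg_hom compmA hs fmor_comp.
have sc_id : compm s c = idm (coalg_obj T).
  have := eP (exist _ _ sc_hom).
  by rewrite -(eP (exist _ _ (is_coalg_hom_id T))) => /(congr1 sval).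
by rewrite hs -fmor_comp sc_id fmor_id.
Qed.

Section Quantale.
Context {d : Order.disp_t} {V : comQuantaleType d}.

(** Bottom is absorbing for the tensor, since an empty join is preserved; so
    [u = 1 * u <= bottom * u = bottom] for every [u]. *)
Lemma unit_le_bottom_trivial : (1 : V) <= bigjoin set0 -> trivial_quantale V.
Proof.
move=> le1.
have le_bot (u : V) : u <= bigjoin set0.
  rewrite -[leLHS]mul1g; apply: le_trans (le_tensr u le1) _.
  by rewrite tensC tens_bigjoin image_set0.
have ge_bot (u : V) : bigjoin set0 <= u by apply: bigjoin_le.
apply/seteqP; split=> // u _ /=; apply/le_anti.
by rewrite !(le_trans (le_bot _) (ge_bot _)).
Qed.

(** Diagonalization over [U], the increasing set generated by the [s A] whose
    distance [w A] from [A] is at most [v]. By reflection [w U] is a join of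
    elements below such [w A], hence [w U <= v] and [s U] is a generator of
    [U], which forces [1 <= w U]. Selecting the [s A] that are not members of
    [A] would not do: the unit may be a join of elements none of which is above
    it, so the failure of [1 <= w A] for each [A] does not pass to the join. *)
Lemma unit_le_of_reflecting_map (X : vcategory V) (s : hausdorff_obj X -> X)
    (v : V) :
  (forall A B, vdist (s A) (s B) <= vdist A B) -> 1 <= v.
Proof.
move=> s_refl.
pose w (A : hausdorff_obj X) : V :=
  bigjoin [set vdist x (s A) | x in sval A].
pose D : set X := [set s A | A in [set A | w A <= v]].
pose U : hausdorff_obj X := exist _ (up D) (increasing_up D).
have sub_DU : D `<=` sval U by exact: sub_up.
have wU_le : w U <= v.
  rewrite /w bigjoin_up; apply: bigjoin_le => _ [_ [A wA <-] <-].
  (* [s A] belongs to [U], so it bounds the meet defining [vdist A U] *)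
  apply: le_trans (s_refl A U) _; apply: le_trans (wA).
  by apply: bigmeet_le; exists (s A) => //; apply: sub_DU; exists A.
have sU_in : sval U (s U) by apply: sub_DU; exists U.
apply: le_trans wU_le; apply: le_trans (vdist_refl (s U)) _.
by apply: le_bigjoin; exists (s U).
Qed.

Lemma no_reflecting_map (X : vcategory V) (s : hausdorff_obj X -> X) :
  ~ trivial_quantale V -> ~ (forall A B, vdist (s A) (s B) <= vdist A B).
Proof.
move=> ntV s_refl; apply/ntV/unit_le_bottom_trivial.
exact: unit_le_of_reflecting_map s_refl.
Qed.

Lemma hausdorff_coalgebra_no_section (X : vcategory V)
    (c : vfunctor X (hausdorff_obj X)) (s : vfunctor (hausdorff_obj X) X) :
  ~ trivial_quantale V -> vfunctor_comp c s <> vfunctor_id (hausdorff_obj X).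
Proof.
move=> ntV cs; apply: (@no_reflecting_map X s ntV) => A B.
have csE D : c (s D) = D := congr1 (fun f : vfunctor _ _ => f D) cs.
by rewrite -{2}(csE A) -{2}(csE B); exact: vfun_le.
Qed.

End Quantale.

Theorem corollary3p19 (d : Order.disp_t) (V : comQuantaleType d)
    (V_nontrivial : ~ trivial_quantale V) :
  ~ admits_terminal_coalgebra (hausdorff V) /\
  (forall (P : VCat V -> Prop) (HP : restricts_to (hausdorff V) P),
     ~ admits_terminal_coalgebra (restriction HP)).
Proof.
split=> [|P HP] [T /terminal_coalgebra_section [s]];
  exact: hausdorff_coalgebra_no_section.
Qed.
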